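(* Assume $1-h\gamma-h\frac{P_{\max}}{2M\bar w^{3/2}}\ge 0$. If $w,w'\in X$, then both the component-wise maximum $w\wedge w'$ and the component-wise minimum $w\vee w'$ belong to $X$; i.e., $(X,\wedge,\vee)$ is a lattice.
   Context: Data: an integer $n\ge 2$; real constants $h,M,P_{\max},g,\mu,\gamma>0$, $c\ge 0$; real angles $\alpha_1,\dots,\alpha_{n-1}$; boundary values $w_{\rm init},w_{\rm fin}\ge 0$; a vector $w^{\max}\in\mathbb{R}^n$ of nonnegative upper bounds with $w^{\max}_1=w_{\rm init}$, $w^{\max}_n=w_{\rm fin}$; and the vector $w^{\min}\in\mathbb{R}^n$ with $w^{\min}_1=w_{\rm init}$, $w^{\min}_n=w_{\rm fin}$, $w^{\min}_i=0$ for $2\le i\le n-1$. The critical value $\bar w>0$ is the solution of $\frac{P_{\max}}{M\sqrt{\bar w}}=g\mu$. $X\subset\mathbb{R}^n$ is the set of all $w$ with $w^{\min}\le w\le w^{\max}$ componentwise (in particular $w_1=w_{\rm init}$, $w_n=w_{\rm fin}$) and, for every $i=1,\dots,n-1$, $$-g\mu\ \le\ \tfrac1h(w_{i+1}-w_i)+\gamma w_i+g(\sin\alpha_i+c)\ \le\ \min\left\{\tfrac{P_{\max}}{M\sqrt{w_i}},\,g\mu\right\},$$ where the minimum on the right is read as $g\mu$ when $w_i=0$ (as it equals $g\mu$ for all $0<w_i\le\bar w$). Notation (paper's convention): $[w\vee w']_i=\min\{w_i,w'_i\}$ and $[w\wedge w']_i=\max\{w_i,w'_i\}$. *)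

(* Defs.v *)
From mathcomp Require Import all_boot all_order all_algebra.
From mathcomp Require Import all_classical all_reals all_analysis.

Set Implicit Arguments.
Unset Strict Implicit.
Unset Printing Implicit Defensive.

Import Order.TTheory GRing.Theory Num.Theory.

Local Open Scope classical_set_scope.
Local Open Scope ring_scope.

(* Vectors of R^n are row vectors ['rV[R]_n]; the mathematical index i in
   {1, ..., n} is the ordinal of value i - 1. *)

Definition wmin_vec (R : realType) (n : nat) (winit wfin : R) : 'rV[R]_n :=
  \row_(i < n) (if val i == 0%N then winit
                else if val i == n.-1 then wfin else 0).

(* The case x = 0 is separate because x / 0 = 0 in MathComp, whereas the power
   bound is infinite there. *)
Definition traction_bound (R : realType) (Pmax M g mu x : R) : R :=
  if x == 0 then g * mu
  else Num.min (Pmax / (M * Num.sqrt x)) (g * mu).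

(* In the last clause k runs over the n - 1 segments, and i, j are its
   endpoints: consecutive indices seen in ['I_n]. *)
Definition feasible_set (R : realType) (n : nat)
    (h M Pmax g mu gamma c : R) (alpha : 'I_n.-1 -> R)
    (winit wfin : R) (wmax : 'rV[R]_n) : set 'rV[R]_n :=
  [set w : 'rV[R]_n |
    (forall i : 'I_n, wmin_vec n winit wfin 0 i <= w 0 i <= wmax 0 i) /\
    (forall (k : 'I_n.-1) (i j : 'I_n), val i = val k -> val j = (val k).+1 ->
       - (g * mu)
         <= h^-1 * (w 0 j - w 0 i) + gamma * w 0 i + g * (sin (alpha k) + c)
         <= traction_bound Pmax M g mu (w 0 i))].

(* Convention of the source: wedge is the maximum and vee is the minimum. *)
Definition cwedge (R : realType) (n : nat) (w w' : 'rV[R]_n) : 'rV[R]_n :=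
  map2_mx Num.max w w'.

Definition cvee (R : realType) (n : nat) (w w' : 'rV[R]_n) : 'rV[R]_n :=
  map2_mx Num.min w w'.

(* Idempotence follows from absorption. *)
Definition is_lattice (T : Type) (X : set T) (wedge vee : T -> T -> T) : Prop :=
  [/\ (forall x y, X x -> X y -> X (wedge x y) /\ X (vee x y)),
      (forall x y, X x -> X y ->
         wedge x y = wedge y x /\ vee x y = vee y x),
      (forall x y z, X x -> X y -> X z ->
         wedge x (wedge y z) = wedge (wedge x y) z /\
         vee x (vee y z) = vee (vee x y) z) &
      (forall x y, X x -> X y ->
         wedge x (vee x y) = x /\ vee x (wedge x y) = x)].

(* Main.v *)
Require Import Defs.
From mathcomp Require Import all_boot all_order all_algebra.
From mathcomp Require Import all_classical all_reals all_analysis.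
From mathcomp Require Import ring lra.

Set Implicit Arguments.
Unset Strict Implicit.
Unset Printing Implicit Defensive.

Import Order.TTheory GRing.Theory Num.Theory.

Local Open Scope classical_set_scope.
Local Open Scope ring_scope.

(** On segment i the constraints read L(w_i) <= w_{i+1} <= F(w_i) with L affine
    of slope 1 - h gamma and F(x) = (1 - h gamma) x + h tau(x) + const, where tau
    is the traction bound. The traction bound is nonincreasing, and Lipschitz with
    constant Pmax / (2 M wbar^(3/2)), so the step-size condition makes both L and
    F nondecreasing on [0, +oo[. Constraints of this form are stable under
    componentwise maximum and minimum. *)

Lemma powR_3half (R : realType) (x : R) : 0 < x -> x `^ (3 / 2) = Num.sqrt x ^+ 3.
Proof.
move=> x_gt0.
have -> : 3 / 2 = 2^-1 * 3%:R :> R by field.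
by rewrite powRrM powR12_sqrt ?ltW// powR_mulrn ?sqrtr_ge0.
Qed.

(* Writing the bound with [Num.max] absorbs both the minimum and the special
   case x = 0. *)
Lemma traction_boundE (R : realType) (Pmax M g mu wbar x : R) :
  0 < M -> 0 < Pmax -> 0 < wbar ->
  Pmax / (M * Num.sqrt wbar) = g * mu -> 0 <= x ->
  traction_bound Pmax M g mu x =
    Pmax / M / Num.max (Num.sqrt wbar) (Num.sqrt x).
Proof.
move=> M_gt0 P_gt0 wbar_gt0 wbar_eq x_ge0; rewrite /traction_bound -wbar_eq.
rewrite -[_ / M / _]mulrA -invfM.
have s_gt0 : 0 < Num.sqrt wbar by rewrite sqrtr_gt0.
case: eqVneq => [->|x_neq0]; first by rewrite sqrtr0 max_l ?ltW.
have r_gt0 : 0 < Num.sqrt x by rewrite sqrtr_gt0 lt0r x_neq0.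
have le_inv (a b : R) : 0 < a -> a <= b -> Pmax / (M * b) <= Pmax / (M * a).
  move=> a_gt0 leab; have b_gt0 := lt_le_trans a_gt0 leab.
  by rewrite ler_pM2l// lef_pV2 ?posrE ?mulr_gt0// ler_pM2l.
case: (leP (Num.sqrt wbar) (Num.sqrt x)) => [le_sr|/ltW le_rs].
  by rewrite min_l// le_inv.
by rewrite min_r// le_inv.
Qed.

Lemma sqr_max_sqrt (R : realType) (x y : R) : 0 <= x -> 0 <= y ->
  Num.max (Num.sqrt x) (Num.sqrt y) ^+ 2 = Num.max x y.
Proof.
move=> x_ge0 y_ge0; case: (leP x y) => [lexy|/ltW leyx].
  by rewrite max_r ?ler_wsqrtr// sqr_sqrtr.
by rewrite max_l ?ler_wsqrtr// sqr_sqrtr.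
Qed.

(** Over a common denominator the left side is (b^2 - a^2) / (a b (a + b)), and a b (a + b) >= 2 s^3
    because a, b >= s. The squares will undo the square roots in the traction bound. *)
Lemma inv_sub_le (R : realType) (s a b : R) : 0 < s -> s <= a -> a <= b ->
  a^-1 - b^-1 <= (b ^+ 2 - a ^+ 2) / (2 * s ^+ 3).
Proof.
move=> s_gt0 lesa leab.
have a_gt0 := lt_le_trans s_gt0 lesa; have b_gt0 := lt_le_trans a_gt0 leab.
have lesb := le_trans lesa leab.
have -> : a^-1 - b^-1 = (b ^+ 2 - a ^+ 2) / ((a * b) * (a + b)).
  by field; rewrite !gt_eqF ?addr_gt0.
rewrite ler_wpM2l ?subr_ge0 ?lerXn2r ?nnegrE ?(ltW a_gt0) ?(ltW b_gt0)//.
rewrite lef_pV2 ?posrE ?mulr_gt0 ?exprn_gt0 ?addr_gt0//.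
have -> : 2 * s ^+ 3 = (s * s) * (s + s) by ring.
by rewrite ler_pM ?mulr_ge0 ?addr_ge0 ?(ltW s_gt0)// ?ler_pM ?lerD ?(ltW s_gt0).
Qed.

(** The bound is constant up to [wbar]; beyond it, Pmax / (M sqrt x) is steepest at x = wbar, and
    the constant is the absolute value of its derivative there. *)
Lemma traction_bound_lipschitz (R : realType) (Pmax M g mu wbar x y : R) :
  0 < M -> 0 < Pmax -> 0 < wbar ->
  Pmax / (M * Num.sqrt wbar) = g * mu -> 0 <= x -> x <= y ->
  traction_bound Pmax M g mu x - traction_bound Pmax M g mu y
    <= Pmax / (2 * M * wbar `^ (3 / 2)) * (y - x).
Proof.
move=> M_gt0 P_gt0 wbar_gt0 wbar_eq x_ge0 lexy.
have y_ge0 := le_trans x_ge0 lexy.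
have s_gt0 : 0 < Num.sqrt wbar by rewrite sqrtr_gt0.
rewrite !(@traction_boundE _ _ _ _ _ wbar)// powR_3half// -mulrBr.
set a := Num.max _ (Num.sqrt x); set b := Num.max _ (Num.sqrt y).
have lesa : Num.sqrt wbar <= a by rewrite le_max lexx.
have leab : a <= b by rewrite ge_max !le_max lexx (ler_wsqrtr lexy) orbT.
(* The squares are max(wbar, x) and max(wbar, y), and t |-> max(wbar, t) is 1-Lipschitz. *)
have le_sqr : b ^+ 2 - a ^+ 2 <= y - x.
  rewrite !sqr_max_sqrt ?(ltW wbar_gt0)//.
  by case: (leP wbar x) => ?; case: (leP wbar y) => ?; lra.
have -> : Pmax / (2 * M * Num.sqrt wbar ^+ 3) * (y - x) =
          Pmax / M * ((y - x) / (2 * Num.sqrt wbar ^+ 3)).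
  by field; rewrite !gt_eqF.
rewrite ler_pM2l ?divr_gt0//; apply: le_trans (inv_sub_le s_gt0 lesa leab) _.
by rewrite ler_pM2r// invr_gt0 mulr_gt0 ?exprn_gt0.
Qed.

Section SegmentSlope.
Variables (R : realType) (h gamma K : R) (tau : R -> R) (l : R).
Hypotheses (h_gt0 : 0 < h) (l_ge0 : 0 <= l) (hstep : 0 <= 1 - h * gamma - h * l).
Hypothesis tau_lip : forall x y, 0 <= x -> x <= y -> tau x - tau y <= l * (y - x).

(** [K] stands for g (sin alpha_k + c), which is fixed on a given segment. *)
Let slope x y := h^-1 * (y - x) + gamma * x + K.

Lemma slope_le_r x y y' : y <= y' -> slope x y <= slope x y'.
Proof. by move=> ley; rewrite !lerD2r ler_pM2l ?invr_gt0// lerD2r. Qed.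

Let rate_ge0 : gamma + l <= h^-1.
Proof. by rewrite -[h^-1]div1r ler_pdivlMr//; move: hstep; lra. Qed.

Lemma slope_ge_l x x' y : x <= x' -> slope x' y <= slope x y.
Proof.
move=> lex; rewrite -subr_ge0.
have -> : slope x y - slope x' y = (h^-1 - gamma) * (x' - x).
  by rewrite /slope; ring.
by apply: mulr_ge0; move: rate_ge0 l_ge0; lra.
Qed.

(** Moving from x to x' lowers the slope by (h^-1 - gamma)(x' - x), which is at least l (x' - x) by
    [rate_ge0], whereas [tau] drops by at most l (x' - x). *)
Lemma slope_le_bound x x' y : 0 <= x -> x <= x' ->
  slope x y <= tau x -> slope x' y <= tau x'.
Proof.
move=> x_ge0 lex le_x.
have -> : slope x' y = slope x y - (h^-1 - gamma) * (x' - x).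
  by rewrite /slope; ring.
have : l * (x' - x) <= (h^-1 - gamma) * (x' - x).
  by apply: ler_wpM2r; move: rate_ge0; lra.
have := tau_lip x_ge0 lex; lra.
Qed.

Lemma slope_lattice lo x x' y y' : 0 <= x -> 0 <= x' ->
  lo <= slope x y <= tau x -> lo <= slope x' y' <= tau x' ->
  (lo <= slope (Num.max x x') (Num.max y y') <= tau (Num.max x x')) /\
  (lo <= slope (Num.min x x') (Num.min y y') <= tau (Num.min x x')).
Proof.
(* Exchanging the two pairs changes neither the maxima nor the minima. *)
wlog lexx' : x x' y y' / x <= x'.
  move=> wlog_le x_ge0 x'_ge0 Hx Hx'; case: (leP x x') => [lexx'|/ltW lex'x].
    by have := wlog_le _ _ _ _ lexx' x_ge0 x'_ge0 Hx Hx';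
      rewrite (max_r lexx') (min_l lexx').
  have := wlog_le _ _ _ _ lex'x x'_ge0 x_ge0 Hx' Hx.
  by rewrite (max_r lex'x) (min_l lex'x) [Num.max y' y]maxC [Num.min y' y]minC.
move=> x_ge0 x'_ge0 /andP[lox upx] /andP[lox' upx'].
rewrite (max_r lexx') (min_l lexx'); split; apply/andP; split.
- by apply: le_trans lox' (slope_le_r _ _); rewrite le_max lexx orbT.
(* Only the mixed pair (x', y) is new; its upper bound comes from (x, y). *)
- case: (leP y y') => _ //; exact: slope_le_bound upx.
(* Here the mixed pair is (x, y'), and its lower bound comes from (x', y'). *)
- case: (leP y y') => _ //; exact: le_trans lox' (slope_ge_l _ lexx').
- by apply: le_trans (slope_le_r _ _) upx; rewrite ge_min lexx.
Qed.

End SegmentSlope.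

Lemma wmin_vec_ge0 (R : realType) (n : nat) (winit wfin : R) (i : 'I_n) :
  0 <= winit -> 0 <= wfin -> 0 <= wmin_vec n winit wfin 0 i.
Proof. by move=> *; rewrite mxE; case: ifP => // _; case: ifP. Qed.

(** Only closure depends on [X]: the algebraic laws hold entrywise for all vectors, since R is
    totally ordered. *)
Lemma is_lattice_cwedge_cvee (R : realType) (n : nat) (X : set 'rV[R]_n) :
  (forall w w', X w -> X w' -> X (cwedge w w') /\ X (cvee w w')) ->
  is_lattice X (@cwedge R n) (@cvee R n).
Proof.
move=> closed; split=> // [x y _ _|x y z _ _ _|x y _ _]; split;
  apply/rowP => i; rewrite !mxE.
- exact: maxC.
- exact: minC.
- exact: maxA.
- exact: minA.
- by case: (leP (x 0 i) (y 0 i)) => [|/ltW]; [rewrite maxxx | exact: max_l].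
- by case: (leP (x 0 i) (y 0 i)) => [|_]; [exact: min_l | rewrite minxx].
Qed.

Theorem proposition7p1 (R : realType) (n : nat) (hn : (2 <= n)%N)
    (h M Pmax g mu gamma c : R)
    (h_gt0 : 0 < h) (M_gt0 : 0 < M) (Pmax_gt0 : 0 < Pmax) (g_gt0 : 0 < g)
    (mu_gt0 : 0 < mu) (gamma_gt0 : 0 < gamma) (c_ge0 : 0 <= c)
    (alpha : 'I_n.-1 -> R)
    (winit wfin : R) (winit_ge0 : 0 <= winit) (wfin_ge0 : 0 <= wfin)
    (wmax : 'rV[R]_n)
    (wmax_ge0 : forall i : 'I_n, 0 <= wmax 0 i)
    (wmax_first : forall i : 'I_n, val i = 0%N -> wmax 0 i = winit)
    (wmax_last : forall i : 'I_n, val i = n.-1 -> wmax 0 i = wfin)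
    (wbar : R) (wbar_gt0 : 0 < wbar)
    (wbar_eq : Pmax / (M * Num.sqrt wbar) = g * mu)
    (hstep : 0 <= 1 - h * gamma - h * (Pmax / (2 * M * wbar `^ (3 / 2)))) :
  let X := feasible_set h M Pmax g mu gamma c alpha winit wfin wmax in
  (forall w w' : 'rV[R]_n, X w -> X w' -> X (cwedge w w') /\ X (cvee w w')) /\
  is_lattice X (@cwedge R n) (@cvee R n).
Proof.
move=> X.
suff closed w w' : X w -> X w' -> X (cwedge w w') /\ X (cvee w w').
  by split=> //; exact: is_lattice_cwedge_cvee.
move=> [box seg] [box' seg'].
(* The box constraints keep all entries in [0, +oo[, where the Lipschitz estimate applies. *)
have w_ge0 i : 0 <= w 0 i.
  by have /andP[+ _] := box i; apply: le_trans; exact: wmin_vec_ge0.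
have w'_ge0 i : 0 <= w' 0 i.
  by have /andP[+ _] := box' i; apply: le_trans; exact: wmin_vec_ge0.
have l_ge0 : 0 <= Pmax / (2 * M * wbar `^ (3 / 2)).
  by rewrite divr_ge0 ?mulr_ge0 ?powR_ge0 ?ltW.
have lip x y : 0 <= x -> x <= y -> _ :=
  @traction_bound_lipschitz _ _ _ _ _ _ x y M_gt0 Pmax_gt0 wbar_gt0 wbar_eq.
have step k i j : val i = val k -> val j = (val k).+1 -> _ :=
  fun ik jk => slope_lattice h_gt0 l_ge0 hstep lip (w_ge0 i) (w'_ge0 i)
    (seg k i j ik jk) (seg' k i j ik jk).
split; split=> [i|k i j ik jk].
- have /andP[lo up] := box i; have /andP[lo' up'] := box' i.
  by rewrite [cwedge _ _ _ _]mxE le_max lo ge_max up up'.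
- by rewrite ![cwedge _ _ _ _]mxE; exact: (step k i j ik jk).1.
- have /andP[lo up] := box i; have /andP[lo' up'] := box' i.
  by rewrite [cvee _ _ _ _]mxE le_min lo lo' ge_min up.
- by rewrite ![cvee _ _ _ _]mxE; exact: (step k i j ik jk).2.
Qed.
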